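(* Consider the convex problem $f^*=\min_{\mathbf{u}\in U} f(\mathbf{u})$ subject to $\mathbf{g}(\mathbf{u})\le\mathbf{0}$ under the assumptions (a), (b), (c) listed in the context. Let $\epsilon>0$ and let $\mathbf{u}^k=\tilde{\mathbf{u}}(\mathbf{y}^k)$ be the primal sequence generated by algorithm IDFGM (with $\theta_k=\frac{2}{k+3}$ for all $k\ge0$) with inner accuracy $\delta$ set so that $$\delta\le\frac{\epsilon^{3/2}}{8L_{\text{d}}^{1/2}R_d}.$$ Then: (i) The primal average iterate $\hat{\mathbf{u}}^k=\frac{2}{(k+1)(k+2)}\sum_{j=0}^k(j+1)\mathbf{u}^j$ is $\epsilon$-optimal after $\left\lfloor\left(\frac{32L_{\text{d}}R_d^2}{\epsilon}\right)^{1/2}\right\rfloor$ outer iterations. (ii) Assuming that the primal iterate $\mathbf{u}^k=\tilde{\mathbf{u}}(\mathbf{y}^k)$ is obtained by applying Nesterov's optimal method to the subproblem $\min_{\mathbf{u}\in U}\mathcal{L}(\mathbf{u},\mathbf{y}^k)$, the average primal iterate $\hat{\mathbf{u}}^k$ is $\epsilon$-optimal after $$\left\lfloor\sqrt{\frac{L_f}{\sigma_f}}\left(\frac{32L_{\text{d}}R_d^2}{\epsilon}\right)^{1/2}\log\left(\frac{4L_{\text{d}}^{1/2}L_fR_p^2R_d}{\epsilon^{3/2}}\right)\right\rfloor$$ total number of projections on the set $U$ and evaluations of $\nabla f$.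
   Context: $\|\cdot\|$ is the Euclidean norm, $\|\cdot\|_F$ the Frobenius norm, $\mathbb{R}^p_+$ the nonnegative orthant, $[\cdot]_+$ the projection onto it; vector inequalities are coordinate-wise. $U\subseteq\mathbb{R}^n$ is a closed convex set, simple in the sense that projection on it is easy (e.g. a box). $\mathbf{g}=[g_1,\dots,g_p]^T$, and $f,g_1,\dots,g_p$ are convex and differentiable over their domains, with $U\subseteq\text{dom} f\cap\bigcap_{i=1}^p\text{dom}\,g_i$. Assumptions: (a) (Slater) there is $\bar{\mathbf{u}}\in\text{relint}(U)$ with $\mathbf{g}(\bar{\mathbf{u}})<\mathbf{0}$. (b) $f$ is strongly convex with constant $\sigma_f>0$ and has Lipschitz continuous gradient with constant $L_f$: $\frac{\sigma_f}{2}\|\mathbf{u}-\mathbf{v}\|^2\le f(\mathbf{u})-(f(\mathbf{v})+\langle\nabla f(\mathbf{v}),\mathbf{u}-\mathbf{v}\rangle)\le\frac{L_f}{2}\|\mathbf{u}-\mathbf{v}\|^2$ for all $\mathbf{u},\mathbf{v}\in U$. (c) There is $c_g>0$ with $\|\nabla\mathbf{g}(\mathbf{u})\|_F\le c_g$ for all $\mathbf{u}\in U$. Definitions. $\mathcal{L}(\mathbf{u},\mathbf{x})=f(\mathbf{u})+\langle\mathbf{x},\mathbf{g}(\mathbf{u})\rangle$; $d(\mathbf{x})=\min_{\mathbf{u}\in U}\mathcal{L}(\mathbf{u},\mathbf{x})$ for $\mathbf{x}\in\mathbb{R}^p_+$; $X^*=\arg\max_{\mathbf{x}\ge\mathbf{0}}d(\mathbf{x})$;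 $L_{\text{d}}=c_g^2/\sigma_f$. A point $\mathbf{u}_\epsilon\in U$ is $\epsilon$-optimal if $|f(\mathbf{u}_\epsilon)-f^*|\le\epsilon$ and $\|[\mathbf{g}(\mathbf{u}_\epsilon)]_+\|\le\epsilon$. For $\mathbf{x}\in\mathbb{R}^p_+$, $\tilde{\mathbf{u}}(\mathbf{x})$ denotes a point with $\tilde{\mathbf{u}}(\mathbf{x})\in U$ and $0\le\mathcal{L}(\tilde{\mathbf{u}}(\mathbf{x}),\mathbf{x})-d(\mathbf{x})\le\delta$, and $\tilde\nabla d(\mathbf{x})=\mathbf{g}(\tilde{\mathbf{u}}(\mathbf{x}))$. Algorithm IDFGM (inexact dual fast gradient method): given $\mathbf{y}^0\in\mathbb{R}^p_+$ and $\delta>0$, for $k\ge0$ (each $k$ being one outer iteration), with $\theta_k=\frac{2}{k+3}$: 1. find $\mathbf{u}^k=\tilde{\mathbf{u}}(\mathbf{y}^k)$, i.e. $\mathbf{u}^k\in U$ with $\mathcal{L}(\mathbf{u}^k,\mathbf{y}^k)-d(\mathbf{y}^k)\le\delta$; 2. $\mathbf{x}^k=[\mathbf{y}^k+\frac{1}{2L_{\text{d}}}\tilde\nabla d(\mathbf{y}^k)]_+$ with $\tilde\nabla d(\mathbf{y}^k)=\mathbf{g}(\mathbf{u}^k)$; 3. $\mathbf{y}^{k+1}=(1-\theta_k)\mathbf{x}^k+\theta_k\big[\mathbf{y}^0+\frac{1}{2L_{\text{d}}}\sum_{j=0}^k\frac{j+1}{2}\tilde\nabla d(\mathbf{y}^j)\big]_+$.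 $R_d=\min_{\mathbf{x}^*\in X^*}\|\mathbf{y}^0-\mathbf{x}^*\|$. Standing assumptions: $\mathbf{y}^0=\mathbf{0}$, $R_d\ge\max\{1,\frac1{c_g},\frac{L_f}{c_g}\}$, $L_{\text{d}}\ge1$. Inner complexity: for each $\mathbf{x}\in\mathbb{R}^p_+$, Nesterov's optimal method for smooth strongly convex minimization, applied to $\min_{\mathbf{u}\in U}\mathcal{L}(\mathbf{u},\mathbf{x})$ from an initial point $\mathbf{v}^0$ (warm-start), is taken to return a point $\tilde{\mathbf{u}}(\mathbf{x})$ with accuracy $\delta$ after $N_\delta=\left\lfloor\sqrt{\frac{L_f}{\sigma_f}}\log\left(\frac{L_fR_p^2}{2\delta}\right)\right\rfloor$ projections on $U$ and evaluations of $\nabla f$, where $R_p$ is a uniform bound, assumed to exist (e.g. the diameter of $U$ if $U$ is compact), with $\|\mathbf{v}^0-\mathbf{u}(\mathbf{x})\|\le R_p$ for all $\mathbf{x}\in\mathbb{R}^p_+$, and $\mathbf{u}(\mathbf{x})=\arg\min_{\mathbf{u}\in U}\mathcal{L}(\mathbf{u},\mathbf{x})$. (Here $\mathbf{g}$ is assumed simple: for $\mathbf{v}\in U$, $\mathbf{x}\in\mathbb{R}^p_+$, the problem $\min_{\mathbf{u}\in U}\{\frac12\|\mathbf{u}-\mathbf{v}\|^2+\langle\mathbf{x},\mathbf{g}(\mathbf{u})\rangle\}$ is solvable in $\mathcal{O}(n)$ operations.)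
   Formalization: In (ii) the inner accuracy δ is taken equal to its largest admissible value ε^{3/2}/(8 L_d^{1/2} R_d), since for much smaller δ the inner count N_δ alone can exceed the stated total. *)

(* Defs.v *)
(* MathComp-Analysis: real vectors are rows ['rV[R]_n] over an abstract
   [R : realType].  The library's norm on ['rV[R]_n] is the sup norm, hence the
   explicit Euclidean norm below; it induces the same topology and the same
   notion of differentiability. *)
From HB Require Import structures.
From mathcomp Require Import all_boot all_order all_algebra.
From mathcomp Require Import all_classical all_reals all_analysis.

Set Implicit Arguments.
Unset Strict Implicit.
Unset Printing Implicit Defensive.

Import Order.TTheory GRing.Theory Num.Theory.
Import numFieldNormedType.Exports.

Local Open Scope classical_set_scope.
Local Open Scope ring_scope.

Section Euclidean.
Context {R : realType}.

Definition dot n (u v : 'rV[R]_n) : R := \sum_(j < n) u 0 j * v 0 j.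

Definition enorm n (u : 'rV[R]_n) : R := Num.sqrt (dot u u).

Definition frobenius m n (A : 'M[R]_(m, n)) : R :=
  Num.sqrt (\sum_(i < m) \sum_(j < n) A i j ^+ 2).

Definition nonneg p (x : 'rV[R]_p) : Prop := forall i, 0 <= x 0 i.

Definition pospart p (x : 'rV[R]_p) : 'rV[R]_p := \row_i Num.max 0 (x 0 i).

Definition affine_hull n (U : set 'rV[R]_n) : set 'rV[R]_n :=
  [set y | exists m (l : 'I_m -> R) (z : 'I_m -> 'rV[R]_n),
    [/\ forall i, U (z i), \sum_i l i = 1 & y = \sum_i l i *: z i]].

Definition relint n (U : set 'rV[R]_n) : set 'rV[R]_n :=
  [set x | U x /\ exists2 r : R, 0 < r &
    forall y, affine_hull U y -> enorm (y - x) < r -> U y].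

Definition grad n (h : 'rV[R]_n -> R) (v : 'rV[R]_n) : 'rV[R]_n :=
  \row_j 'd h v (delta_mx 0 j).

(* A function with domain [D] is a total function whose values outside [D] are
   irrelevant; [D] need not be open. *)
Definition convex_differentiable n (D : set 'rV[R]_n) (h : 'rV[R]_n -> R) :=
  [/\ convex_set D, convex_function D h & forall v, D v -> differentiable h v].

Definition is_argmin n (U : set 'rV[R]_n) (h : 'rV[R]_n -> R) (u : 'rV[R]_n) :=
  U u /\ forall v, U v -> h u <= h v.

End Euclidean.

Section Problem.
Context {R : realType} {n p : nat}.
Variables (U : set 'rV[R]_n).
Variables (f : 'rV[R]_n -> R) (g : 'I_p -> 'rV[R]_n -> R).

Definition gvec (u : 'rV[R]_n) : 'rV[R]_p := \row_i g i u.

Definition jac_g (u : 'rV[R]_n) : 'M[R]_(p, n) := \matrix_(i, j) grad (g i) u 0 j.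

Definition lagrangian (u : 'rV[R]_n) (x : 'rV[R]_p) : R := f u + dot x (gvec u).

(* [opt_value], [dual] and [dual_dist] are minima: under strong convexity of [f]
   and Slater's condition all three infima are attained. *)
Definition opt_value : R :=
  inf [set f u | u in [set u | U u /\ forall i, g i u <= 0]].

Definition dual (x : 'rV[R]_p) : R := inf [set lagrangian u x | u in U].

Definition dual_opt : set 'rV[R]_p :=
  [set x | nonneg x /\ forall z, nonneg z -> dual z <= dual x].

Definition dual_dist (y0 : 'rV[R]_p) : R :=
  inf [set enorm (y0 - x) | x in dual_opt].

Definition eps_optimal (eps : R) (u : 'rV[R]_n) : Prop :=
  [/\ U u, `|f u - opt_value| <= eps & enorm (pospart (gvec u)) <= eps].

Definition inexact_min (delta : R) (x : 'rV[R]_p) (v : 'rV[R]_n) : Prop :=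
  U v /\ 0 <= lagrangian v x - dual x <= delta.

Definition theta (k : nat) : R := 2 / (k%:R + 3).

(* The outer updates of the dual fast gradient method; how [u k] is obtained
   from [y k] is specified separately. *)
Definition dual_fast_gradient (Ld : R) (y0 : 'rV[R]_p)
    (u : nat -> 'rV[R]_n) (x y : nat -> 'rV[R]_p) : Prop :=
  [/\ y 0%N = y0,
      forall k, x k = pospart (y k + (2 * Ld)^-1 *: gvec (u k)) &
      forall k, y k.+1 = (1 - theta k) *: x k + theta k *: pospart
        (y0 + (2 * Ld)^-1 *: \sum_(j < k.+1) (j.+1%:R / 2) *: gvec (u j))].

Definition IDFGM (delta Ld : R) (y0 : 'rV[R]_p)
    (u : nat -> 'rV[R]_n) (x y : nat -> 'rV[R]_p) : Prop :=
  dual_fast_gradient Ld y0 u x y /\ forall k, inexact_min delta (y k) (u k).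

Definition primal_average (u : nat -> 'rV[R]_n) (k : nat) : 'rV[R]_n :=
  (2 / (k.+1%:R * k.+2%:R)) *: \sum_(j < k.+1) j.+1%:R *: u j.

(* [u] is the output of [N] iterations, started at [v0], of Nesterov's
   constant-step optimal method for [min_U (lagrangian ^~ x)], with the simple
   term [<x, g>] kept in the projection subproblem:  [v] are the iterates and
   [w] the extrapolated points, which may leave [U] but must stay where [f] is
   defined.  Each iteration costs exactly one (generalized) projection on [U]
   and one evaluation of [grad f]. *)
Definition nesterov_output (domf : set 'rV[R]_n) (sf Lf : R) (N : nat)
    (x : 'rV[R]_p) (v0 u : 'rV[R]_n) : Prop :=
  let beta := (Num.sqrt Lf - Num.sqrt sf) / (Num.sqrt Lf + Num.sqrt sf) in
  exists v w : nat -> 'rV[R]_n,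
    [/\ v 0%N = v0 /\ w 0%N = v0,
        forall m, (m < N)%N -> domf (w m),
        forall m, (m < N)%N ->
          is_argmin U (fun z => dot (grad f (w m)) (z - w m)
            + Lf / 2 * enorm (z - w m) ^+ 2 + dot x (gvec z)) (v m.+1),
        forall m, (m < N)%N -> w m.+1 = v m.+1 + beta *: (v m.+1 - v m) &
        u = v N].

End Problem.

(* [Num.truncn] is the floor, as a natural number (0 on negative reals). *)
Definition nesterov_steps {R : realType} (sf Lf Rp delta : R) : nat :=
  Num.truncn (Num.sqrt (Lf / sf) * ln (Lf * Rp ^+ 2 / (2 * delta))).

(* Main.v *)
Require Import Defs.
From HB Require Import structures.
From mathcomp Require Import all_boot all_order all_algebra.
From mathcomp Require Import all_classical all_reals all_analysis.
From mathcomp Require Import ring lra.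

(** The proof is a Lagrangian duality argument in which every minimisation over
    [U] is replaced by an approximate one.

    A [delta]-minimiser [u] of the Lagrangian at a multiplier [y] gives two-sided
    first-order information on the concave function [dual]: the affine function
    [lagrangian u] is an upper bound, and subtracting
    [Ld |x - y|^2 + 2 delta] makes it a lower bound ([inexact_oracle]).  The
    lower bound uses the strong convexity of [f] and the Lipschitz bound on [g]
    that follows from the Jacobian bound ([gvec_lipschitz]).  Nesterov's
    estimate-sequence argument then applies to the dual method
    ([dfg_estimate]); the oracle errors add up to [2 delta (k + 3) / 3].

    The estimate bounds [dual] from below by a maximum over all multipliers of an
    expression that contains the weighted sum of the Lagrangians of the [u j].  By
    convexity this sum dominates the Lagrangian of the primal average, and choosing
    the multiplier proportional to the infeasibility of the average gives
    ([dfg_primal_bound]), with [uhat] the average and [G] the norm of its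
    infeasibility,
      [f uhat + (weight k / (4 Ld)) G^2 <= f* + 2 delta (k + 3) / 3].
    In the opposite direction strong duality yields [f* - f uhat <= Rd G] and
    [f* - f uhat <= Ld Rd^2].  Solving these inequalities for [f uhat - f*] and
    [G] is elementary ([eps_optimal_arith]); the only delicate point is the
    rounding of the iteration count, which is costly for few iterations.

    Strong duality follows from the same oracle: at a dual optimum,
    approximate minimisers are nearly feasible and nearly complementary
    ([near_saddle]), and Slater's point repairs feasibility ([strong_duality]).
    A dual optimum exists because [Rd], an infimum of distances to the set of dual
    optima, is positive, while the infimum of the empty set is [0]. *)

Set Implicit Arguments.
Unset Strict Implicit.
Unset Printing Implicit Defensive.

Import Order.TTheory GRing.Theory Num.Theory.
Import numFieldNormedType.Exports.
Local Open Scope classical_set_scope.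
Local Open Scope ring_scope.

(** * Euclidean inner product and projection on the orthant *)

Section Euclid.
Context {R : realType}.

Lemma dotC n (u v : 'rV[R]_n) : dot u v = dot v u.
Proof. by apply: eq_bigr => j _; rewrite mulrC. Qed.

Lemma dotDr n (u v w : 'rV[R]_n) : dot u (v + w) = dot u v + dot u w.
Proof. by rewrite -big_split/=; apply: eq_bigr => j _; rewrite mxE mulrDr. Qed.

Lemma dotZr n a (u v : 'rV[R]_n) : dot u (a *: v) = a * dot u v.
Proof. by rewrite mulr_sumr; apply: eq_bigr => j _; rewrite mxE mulrCA. Qed.

Lemma dotNr n (u v : 'rV[R]_n) : dot u (- v) = - dot u v.
Proof. by rewrite -scaleN1r dotZr mulN1r. Qed.

Lemma dotDl n (u v w : 'rV[R]_n) : dot (u + v) w = dot u w + dot v w.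
Proof. by rewrite !(dotC _ w) dotDr. Qed.

Lemma dotZl n a (u v : 'rV[R]_n) : dot (a *: u) v = a * dot u v.
Proof. by rewrite !(dotC _ v) dotZr. Qed.

Lemma dotNl n (u v : 'rV[R]_n) : dot (- u) v = - dot u v.
Proof. by rewrite !(dotC _ v) dotNr. Qed.

Lemma dot0l n (u : 'rV[R]_n) : dot 0 u = 0.
Proof. by rewrite -(scale0r u) dotZl mul0r. Qed.

Lemma dot_sumr n m (u : 'rV[R]_n) (v : 'I_m -> 'rV[R]_n) :
  dot u (\sum_i v i) = \sum_i dot u (v i).
Proof.
elim/big_rec2: _ => [|i a b _ <-]; first by rewrite dotC dot0l.
by rewrite dotDr.
Qed.

Definition dotE := (dotDl, dotDr, dotNl, dotNr, dotZl, dotZr).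

Lemma dot_delta n (u : 'rV[R]_n) j : dot (delta_mx 0 j) u = u 0 j.
Proof.
rewrite /dot (bigD1 j)//= !mxE !eqxx mul1r big1 ?addr0// => i ij.
by rewrite !mxE (negbTE ij) andbF mul0r.
Qed.

Lemma dot_ge0 n (u : 'rV[R]_n) : 0 <= dot u u.
Proof. by apply: sumr_ge0 => j _; rewrite -expr2 sqr_ge0. Qed.

Lemma sqr_enorm n (u : 'rV[R]_n) : enorm u ^+ 2 = dot u u.
Proof. by rewrite sqr_sqrtr// dot_ge0. Qed.

Lemma enorm_ge0 n (u : 'rV[R]_n) : 0 <= enorm u.
Proof. exact: sqrtr_ge0. Qed.

Lemma enormN n (u : 'rV[R]_n) : enorm (- u) = enorm u.
Proof. by rewrite /enorm dotNl dotNr opprK. Qed.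

Lemma enormB n (u v : 'rV[R]_n) : enorm (u - v) = enorm (v - u).
Proof. by rewrite -opprB enormN. Qed.

Lemma dot_eq0 n (u v : 'rV[R]_n) : dot u u = 0 -> dot u v = 0.
Proof.
move=> /eqP; rewrite psumr_eq0; last by move=> j _; rewrite -expr2 sqr_ge0.
move=> /allP u0; apply: big1 => j _.
have /eqP := u0 j (mem_index_enum _).
by move=> /eqP; rewrite /= mulf_eq0 orbb => /eqP ->; rewrite mul0r.
Qed.

Lemma cauchy_schwarz n (u v : 'rV[R]_n) : dot u v <= enorm u * enorm v.
Proof.
have := dot_ge0 (enorm v *: u - enorm u *: v).
rewrite !dotE -!sqr_enorm (dotC v u).
have := enorm_ge0 u; have := enorm_ge0 v.
rewrite le_eqVlt => /orP[/eqP v0 _ _|v0].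
  by rewrite -v0 mulr0 dotC dot_eq0// -sqr_enorm -v0 expr0n.
rewrite le_eqVlt => /orP[/eqP u0 _|u0].
  by rewrite -u0 mul0r dot_eq0// -sqr_enorm -u0 expr0n.
have uv0 : 0 < enorm u * enorm v by rewrite mulr_gt0.
move=> H; rewrite -(ler_pM2l uv0); nra.
Qed.

Lemma abs_dot_le n (u v : 'rV[R]_n) : `|dot u v| <= enorm u * enorm v.
Proof.
by rewrite ler_norml cauchy_schwarz andbT lerNl -dotNl -(enormN u) cauchy_schwarz.
Qed.

(** Cauchy-Schwarz in the image space and again in each row: the operator norm
    of a matrix is at most its Frobenius norm. *)
Lemma frobenius_bilinear_le m n (A : 'M[R]_(m, n)) (w : 'rV[R]_m) (d : 'rV[R]_n) :
  `|\sum_i w 0 i * dot (row i A) d| <= enorm w * frobenius A * enorm d.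
Proof.
pose Ad := \row_i dot (row i A) d : 'rV[R]_m.
have -> : \sum_i w 0 i * dot (row i A) d = dot w Ad.
  by apply: eq_bigr => i _; rewrite mxE.
apply: (le_trans (abs_dot_le _ _)); rewrite -mulrA ler_wpM2l ?enorm_ge0//.
rewrite -(@ler_pXn2r _ 2)// ?nnegrE ?enorm_ge0//; last first.
  by rewrite mulr_ge0 ?enorm_ge0// sqrtr_ge0.
rewrite exprMn sqr_enorm sqr_sqrtr; last first.
  by do 2![apply: sumr_ge0 => ? _]; rewrite sqr_ge0.
rewrite mulr_suml; apply: ler_sum => i _; rewrite mxE -expr2.
have -> : \sum_j A i j ^+ 2 = enorm (row i A) ^+ 2.
  by rewrite sqr_enorm; apply: eq_bigr => j _; rewrite mxE.
by rewrite -exprMn -ler_sqrt ?sqr_ge0// !sqrtr_sqr (le_trans (abs_dot_le _ _))// ler_norm.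
Qed.

Lemma pospart_ge0 p (q : 'rV[R]_p) : nonneg (pospart q).
Proof. by move=> i; rewrite mxE le_max lexx. Qed.

Lemma dot_pospart_le p (x q : 'rV[R]_p) :
  nonneg x -> dot x q <= enorm x * enorm (pospart q).
Proof.
move=> x0; apply: le_trans (cauchy_schwarz _ _).
by apply: ler_sum => i _; rewrite mxE ler_wpM2l// le_max lexx orbT.
Qed.

Lemma dot_pospart p (q : 'rV[R]_p) :
  dot (pospart q) q = enorm (pospart q) ^+ 2.
Proof.
rewrite sqr_enorm; apply: eq_bigr => i _; rewrite mxE.
by case: leP => _; rewrite ?mul0r.
Qed.

(** The objective [<s, x - y> - L |x - y|^2] is strongly concave with maximiser
    [z] over the orthant, so the value at [x] loses a quadratic term in [x - z].
    The maximisation is separable in the coordinates. *)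
Lemma prox_step p (L : R) (s y x : 'rV[R]_p) : 0 < L -> nonneg x ->
  let z := pospart (y + (2 * L)^-1 *: s) in
  dot (x - y) s - L * enorm (x - y) ^+ 2 + L * enorm (x - z) ^+ 2 <=
  dot (z - y) s - L * enorm (z - y) ^+ 2.
Proof.
move=> L0 x0 /=; rewrite !sqr_enorm /dot !mulr_sumr -!sumrN -!big_split/=.
apply: ler_sum => i _; rewrite !mxE.
set si := s 0 i; set yi := y 0 i; have := x0 i; set xi := x 0 i => xi0.
(* Measured in steps of length 1 / (2 L), the gradient disappears and both
   cases of the maximum become quadratic inequalities. *)
have [q Eq] : exists q, si = 2 * L * q by exists ((2 * L)^-1 * si); field; lra.
rewrite Eq mulKf; last by lra.
case: (leP 0 (yi + q)) => h; first nra.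
have := mulr_ge0 (ltW L0) xi0; nra.
Qed.

End Euclid.

(** * Convexity and differentiability on a convex set *)

Section Calculus.
Context {R : realType} {n : nat}.
Implicit Types (U D : set 'rV[R]_n) (u v : 'rV[R]_n) (t : R).

Lemma convex_set_segment U u v t : convex_set U -> U u -> U v ->
  0 <= t -> t <= 1 -> U ((1 - t) *: u + t *: v).
Proof.
move=> Uc Uu Uv t0 t1; have := Uc v u (Itv01 t0 t1).
by rewrite !inE addrC => /(_ Uv Uu).
Qed.

Lemma convex_function_segment D (h : 'rV[R]_n -> R) u v t :
  convex_function D h -> D u -> D v -> 0 <= t -> t <= 1 ->
  h ((1 - t) *: u + t *: v) <= (1 - t) * h u + t * h v.
Proof.
move=> hc Du Dv t0 t1; have := hc (Itv01 t0 t1) v u.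
rewrite !inE convRE/= => /(_ Dv Du).
by rewrite [X in _ -> h X <= _]addrC [X in _ -> _ <= X]addrC.
Qed.

Lemma convex_functionS D U (h : 'rV[R]_n -> R) :
  U `<=` D -> convex_function D h -> convex_function U h.
Proof.
move=> UD hc t u v; rewrite !inE => Uu Uv.
by apply: hc; rewrite inE; exact: UD.
Qed.

Lemma diff_grad (h : 'rV[R]_n -> R) u v :
  differentiable h u -> 'd h u v = dot (grad h u) v.
Proof.
move=> hu; rewrite [v in LHS]row_sum_delta linear_sum/=.
by apply: eq_bigr => j _; rewrite linearZ/= mxE mulrC.
Qed.

Lemma is_derive_line (h : 'rV[R]_n -> R) u v t :
  differentiable h (u + t *: v) ->
  is_derive t 1 (fun s => h (u + s *: v)) (dot (grad h (u + t *: v)) v).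
Proof.
move=> hd; rewrite -diff_grad// -deriveE//.
have E : (fun s : R => s^-1 *: (((fun s => h (u + s *: v)) \o shift t) (s *: 1)
    - h (u + t *: v))) =
  (fun s : R => s^-1 *: ((h \o shift (u + t *: v)) (s *: v) - h (u + t *: v))).
  apply/funext => s /=; congr (_ *: (h _ - _)).
  by rewrite [s *: 1]mulr1 scalerDl addrCA.
by split; rewrite /derivable/derive E//; exact: diff_derivable.
Qed.

Context {p : nat} (g : 'I_p -> 'rV[R]_n -> R).

(** Mean value theorem for the scalar function [s |-> <w, g (v + s (u - v))>],
    whose derivative is a bilinear form in the Jacobian.  Testing against one
    multiplier [w] at a time is what makes a scalar theorem sufficient. *)
Lemma gvec_lipschitz U cg : convex_set U ->
  (forall i u, U u -> differentiable (g i) u) ->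
  (forall u, U u -> frobenius (jac_g g u) <= cg) ->
  forall w u v, U u -> U v ->
  dot w (gvec g u) - dot w (gvec g v) <= cg * enorm w * enorm (u - v).
Proof.
move=> Uc gd gJ w u v Uu Uv.
pose z s := v + s *: (u - v); set d := u - v.
have Uz (s : R) : s \in `[0, 1] -> U (z s).
  rewrite in_itv/= => /andP[s0 s1].
  have -> : z s = (1 - s) *: v + s *: u.
    by rewrite /z scalerBr scalerBl scale1r addrAC addrA.
  exact: convex_set_segment.
pose phi := \sum_i (fun s : R => w 0 i * g i (z s)).
pose dphi s := \sum_i w 0 i * dot (grad (g i) (z s)) d.
have phiE s : phi s = dot w (gvec g (z s)).
  by rewrite /phi fct_sumE; apply: eq_bigr => i _; rewrite mxE.
have phid (s : R) : s \in `[0, 1] -> is_derive s 1 phi (dphi s).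
  move=> s01; apply: is_derive_sum => i.
  have H := is_derive_line (gd i _ (Uz _ s01)).
  exact: (is_deriveZ (w 0 i) H).
have oo_cc (s : R) : s \in `]0, 1[ -> s \in `[0, 1].
  by rewrite !in_itv/= => /andP[/ltW -> /ltW ->].
have phic : {within `[0, 1], continuous phi}.
  apply: derivable_within_continuous => s s01.
  by have [sd _] := phid s s01.
have [s /oo_cc s01] := MVT (@ltr01 R) (fun s s01 => phid s (oo_cc s s01)) phic.
rewrite !phiE subr0 mulr1 /z scale1r scale0r addr0 subrKC => ->.
have -> : dphi s = \sum_i w 0 i * dot (row i (jac_g g (z s))) d.
  by apply: eq_bigr => i _; congr (_ * dot _ _); apply/rowP => j; rewrite !mxE.
apply: (le_trans (ler_norm _)); apply: (le_trans (frobenius_bilinear_le _ _ _)).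
by rewrite (mulrC cg) ler_wpM2r ?enorm_ge0// ler_wpM2l ?enorm_ge0// gJ//; exact: Uz.
Qed.

(** Adding the two first-order bounds at the midpoint cancels the gradient. *)
Lemma strongly_convex_midpoint U (f : 'rV[R]_n -> R) sf : convex_set U ->
  (forall u v, U u -> U v ->
     f v + dot (grad f v) (u - v) + sf / 2 * enorm (u - v) ^+ 2 <= f u) ->
  forall u v, U u -> U v ->
  f ((1 - 2^-1) *: u + 2^-1 *: v) + sf / 8 * enorm (u - v) ^+ 2 <=
  (f u + f v) / 2.
Proof.
move=> Uc fs u v Uu Uv; set m := (_ *: u + _).
have Um : U m by apply: convex_set_segment => //; lra.
have := fs _ _ Uu Um; have := fs _ _ Uv Um.
have -> : u - m = 2^-1 *: (u - v) by apply/rowP => j; rewrite !mxE; lra.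
have -> : v - m = - (2^-1 *: (u - v)) by apply/rowP => j; rewrite !mxE; lra.
rewrite enormN dotNr dotZr [enorm (_ *: _) ^+ 2]sqr_enorm dotZl dotZr -sqr_enorm.
by lra.
Qed.

End Calculus.

(** * Lagrangian duality without attained minima *)

Section Duality.
Context {R : realType} {n p : nat} {U : set 'rV[R]_n}.
Context {f : 'rV[R]_n -> R} {g : 'I_p -> 'rV[R]_n -> R} {sf cg : R}.
Context (U_conv : convex_set U) (f_conv : convex_function U f).
Context (g_conv : forall i, convex_function U (g i)) (sf_gt0 : 0 < sf).
Context (f_growth : forall u v, U u -> U v ->
  f v + dot (grad f v) (u - v) + sf / 2 * enorm (u - v) ^+ 2 <= f u).
Context (g_lip : forall w u v, U u -> U v ->
  dot w (gvec g u) - dot w (gvec g v) <= cg * enorm w * enorm (u - v)).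

Local Notation Lag := (lagrangian f g).
Local Notation d := (dual U f g).
Local Notation Ld := (cg ^+ 2 / sf).

Lemma quadratic_lower (a c t : R) :
  0 < a -> - (c ^+ 2 / (4 * a)) <= a * t ^+ 2 - c * t.
Proof.
move=> a0; rewrite -subr_ge0.
have -> : a * t ^+ 2 - c * t - - (c ^+ 2 / (4 * a)) = (2 * a * t - c) ^+ 2 / (4 * a).
  by field; lra.
by rewrite divr_ge0 ?sqr_ge0//; lra.
Qed.

Lemma lagrangianE u x y : Lag u x = Lag u y + dot (x - y) (gvec g u).
Proof. by rewrite /lagrangian dotDl dotNl; lra. Qed.

(** The quadratic growth of [f] beats the linear growth of [g].  Without this bound
    the infimum defining [dual] would be a junk value. *)
Lemma lagrangian_lbound v x : U v -> has_lbound [set Lag u x | u in U].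
Proof.
(* [c] bounds the slope at [v] of the linear part of the Lagrangian. *)
move=> Uv; pose c := cg * enorm x + enorm (grad f v).
exists (Lag v x - c ^+ 2 / (4 * (sf / 2))) => _ [u Uu <-].
have sf2 : 0 < sf / 2 by rewrite divr_gt0.
have q := quadratic_lower c (enorm (u - v)) sf2.
have := g_lip x Uv Uu; rewrite (enormB v u).
have := f_growth Uu Uv.
have := cauchy_schwarz (- grad f v) (u - v); rewrite enormN dotNl.
by move: q; rewrite /lagrangian; move: (c ^+ 2 / _) => z; rewrite /c; lra.
Qed.

Lemma dual_le u x : U u -> d x <= Lag u x.
Proof. by move=> Uu; apply: ge_inf; [exact: lagrangian_lbound Uu|exists u]. Qed.

Lemma lagrangian_mid u v x : nonneg x -> U u -> U v ->
  Lag ((1 - 2^-1) *: u + 2^-1 *: v) x + sf / 8 * enorm (u - v) ^+ 2 <=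
  (Lag u x + Lag v x) / 2.
Proof.
move=> x0 Uu Uv; rewrite /lagrangian.
have := strongly_convex_midpoint U_conv f_growth Uu Uv.
suff : dot x (gvec g ((1 - 2^-1) *: u + 2^-1 *: v)) <=
    dot x ((1 - 2^-1) *: gvec g u + 2^-1 *: gvec g v).
  by rewrite dotDr !dotZr; lra.
apply: ler_sum => i _; rewrite ler_wpM2l// !mxE.
by apply: (convex_function_segment (g_conv i)) => //; lra.
Qed.

(** A [delta]-minimiser [u] at [y] yields a concave quadratic minorant of [dual]
    with curvature doubled and error [2 delta].  The value at the midpoint of
    [u] and any competitor [v] is at least [dual y], so the Lagrangian at [v]
    exceeds the one at [u] by [sf / 4 |u - v|^2 - 2 delta]; moving the
    multiplier from [y] to [x] costs at most [cg |x - y| |u - v|], and the worst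
    [v] gives the constant [cg^2 / sf].  Comparing with [u] itself rather than
    with an exact minimiser avoids proving that one exists. *)
Lemma inexact_oracle delta u y x : nonneg y -> U u -> Lag u y - d y <= delta ->
  Lag u x - Ld * enorm (x - y) ^+ 2 - 2 * delta <= d x.
Proof.
move=> y0 Uu ud; apply: lb_le_inf; first by exists (Lag u x), u.
move=> _ [v Uv <-]; rewrite (lagrangianE v x y) (lagrangianE u x y).
have := lagrangian_mid y0 Uu Uv.
have : d y <= Lag ((1 - 2^-1) *: u + 2^-1 *: v) y.
  by apply: dual_le; apply: convex_set_segment => //; lra.
have := g_lip (x - y) Uu Uv.
have sf4 : 0 < sf / 4 by rewrite divr_gt0.
have := quadratic_lower (cg * enorm (x - y)) (enorm (u - v)) sf4.
have -> : (cg * enorm (x - y)) ^+ 2 / (4 * (sf / 4)) = Ld * enorm (x - y) ^+ 2.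
  by field; rewrite gt_eqF.
by lra.
Qed.

Lemma near_minimizer x e u0 :
  U u0 -> 0 < e -> exists2 u, U u & Lag u x - d x <= e.
Proof.
move=> Uu0 e0.
have hi : has_inf [set Lag u x | u in U].
  by split; [exists (Lag u0 x), u0|exact: lagrangian_lbound Uu0].
have [_ [u Uu <-] ue] := inf_adherent e0 hi.
by exists u => //; rewrite lerBlDl ltW.
Qed.

(** Feasibility and complementary slackness at a dual optimum, up to errors of
    order [t].  The minorant of [dual] supported by a [t^2]-minimiser lies below
    the maximal value, which bounds [<v, g u>] by [O(t^2)] along every admissible
    displacement [v] of size [t].  Displacements along the coordinate directions
    give feasibility, displacements along [xs] and [- xs] give slackness. *)
Lemma near_saddle xs t u0 :
  dual_opt U f g xs -> U u0 -> 0 < t -> t <= 1 ->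
  exists u, [/\ U u, Lag u xs <= d xs + t ^+ 2,
    forall i, g i u <= (Ld + 2) * t &
    `|dot xs (gvec g u)| <= (Ld * enorm xs ^+ 2 + 2) * t].
Proof.
move=> [xs0 xsmax] Uu0 t0 t1.
have t20 : 0 < t ^+ 2 by rewrite exprn_gt0.
have [u Uu ut] := near_minimizer xs Uu0 t20.
have dle := dual_le xs Uu.
have key v : nonneg (xs + v) -> dot v (gvec g u) <= Ld * enorm v ^+ 2 + 2 * t ^+ 2.
  move=> /[dup] xv /xsmax; have := inexact_oracle (xs + v) xs0 Uu ut.
  rewrite (lagrangianE u (xs + v) xs).
  by rewrite (_ : xs + v - xs = v) ?[xs + v]addrC ?addrK//; lra.
exists u; split => //; first by lra.
- move=> i; have /key : nonneg (xs + t *: delta_mx 0 i).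
    by move=> j; rewrite !mxE addr_ge0// mulr_ge0// ?ler0n// ltW.
  rewrite dotZl dot_delta mxE sqr_enorm dotZl dotZr dot_delta mxE !eqxx/=.
  by move=> H; rewrite -(ler_pM2l t0); nra.
- have E (e : R) : e ^+ 2 = 1 -> e * dot xs (gvec g u) <= (Ld * enorm xs ^+ 2 + 2) * t.
    move=> e1; have /key : nonneg (xs + (t * e) *: xs).
      move=> j; rewrite !mxE -[X in X + _]mul1r -mulrDl mulr_ge0//.
      have /orP[/eqP->|/eqP->] : (e == 1) || (e == - 1).
        by rewrite -eqf_sqr e1 expr1n.
      - by lra.
      - by lra.
    rewrite dotZl sqr_enorm dotZl dotZr -sqr_enorm.
    have -> : t * e * (t * e * enorm xs ^+ 2) = t ^+ 2 * (e ^+ 2 * enorm xs ^+ 2) by ring.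
    rewrite e1 => H; rewrite -(ler_pM2l t0); nra.
  have eN1 : (- 1) ^+ 2 = 1 :> R by rewrite sqrrN expr1n.
  by rewrite ler_norml; have := E 1 (expr1n _ _); have := E (- 1) eN1; lra.
Qed.

Lemma weak_duality x u :
  nonneg x -> U u -> (forall i, g i u <= 0) -> d x <= f u.
Proof.
move=> x0 Uu gu; apply: (le_trans (dual_le x Uu)).
rewrite /lagrangian gerDl; apply: sumr_le0 => i _.
by rewrite mulr_ge0_le0// mxE.
Qed.

Lemma dual_le_opt_value x u : nonneg x -> U u -> (forall i, g i u <= 0) ->
  d x <= opt_value U f g.
Proof.
move=> x0 Uu gu; apply: lb_le_inf; first by exists (f u), u.
by move=> _ [v [Uv gv] <-]; exact: weak_duality.
Qed.

Lemma dual_at_zero u : Lag u 0 = f u.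
Proof. by rewrite /lagrangian dot0l addr0. Qed.

Lemma le_of_small_error (a b C : R) :
  (forall t, 0 < t -> t <= 1 -> a <= b + C * t) -> a <= b.
Proof.
move=> H; apply/ler_addgt0Pr => e e0.
pose t := Num.min 1 (e / (1 + `|C|)).
have C1 : 0 < 1 + `|C| by rewrite ltr_pwDl.
have t0 : 0 < t by rewrite lt_min ltr01 divr_gt0.
apply: (le_trans (H t t0 _)); first by rewrite ge_min lexx.
rewrite lerD2l (le_trans (_ : _ <= (1 + `|C|) * t))//.
  by rewrite ler_pM2r//; have := ler_norm C; lra.
by rewrite mulrC -ler_pdivlMr// ge_min lexx orbT.
Qed.

Lemma slater_margin ubar : (forall i, g i ubar < 0) ->
  exists2 m, 0 < m & forall i, g i ubar <= - m.
Proof.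
move=> gu; exists (\big[Order.min/1]_i (- g i ubar)).
  by apply: lt_bigmin => [|i _]; rewrite ?ltr01// oppr_gt0.
by move=> i; rewrite lerNr; exact: bigmin_le.
Qed.

(** The points of [near_saddle] have almost the dual value but are only almost
    feasible.  Moving them towards the Slater point by a fraction of order [t]
    makes them feasible at a cost of order [t]. *)
Lemma strong_duality xs ubar : dual_opt U f g xs ->
  U ubar -> (forall i, g i ubar < 0) -> opt_value U f g = d xs.
Proof.
move=> xsopt Ub gb; have [xs0 _] := xsopt.
apply/eqP; rewrite eq_le; apply/andP; split; last first.
  by apply: dual_le_opt_value Ub _ => // i; exact: ltW.
have [m m0 gm] := slater_margin gb.
pose F := f ubar - d 0.
have Fle u : U u -> f ubar - f u <= F.
  by move=> /(dual_le 0); rewrite dual_at_zero /F; lra.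
have F0 : 0 <= F by rewrite -(subrr (f ubar)) Fle.
pose c := Ld + 2; pose c' := Ld * enorm xs ^+ 2 + 2.
have c0 : 0 < c by rewrite /c ltr_wpDl// divr_ge0// ?sqr_ge0// ltW.
(* The fraction [c * t / m] of the way to [ubar] absorbs a violation [c * t];
   it is at most 1 once [t <= m / c]. *)
pose r := Num.min 1 (m / c).
have r0 : 0 < r by rewrite lt_min ltr01 divr_gt0.
have r1 : r <= 1 by rewrite ge_min lexx.
have rm : c * r <= m by rewrite mulrC -ler_pdivlMr// ge_min lexx orbT.
apply: (@le_of_small_error _ _ ((1 + c' + c / m * F) * r)) => s s0 s1.
pose t := r * s.
have t0 : 0 < t by rewrite mulr_gt0.
have tr : t <= r by rewrite ger_pMr.
have t1 : t <= 1 := le_trans tr r1.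
have [u [Uu Lu gu xu]] := near_saddle xsopt Ub t0 t1.
pose l := c * t / m.
have l0 : 0 <= l by rewrite divr_ge0 ?mulr_ge0// ltW.
have l1 : l <= 1.
  by rewrite ler_pdivrMr// mul1r (le_trans _ rm)// ler_wpM2l// ltW.
have lm : l * m = c * t by rewrite divfK// gt_eqF.
pose v := (1 - l) *: u + l *: ubar.
apply: (@le_trans _ _ (f v)).
  apply: ge_inf; first by exists (d xs) => _ [w [Uw gw] <-]; exact: weak_duality.
  exists v => //; split => [|i]; first exact: convex_set_segment.
  apply: (le_trans (convex_function_segment (g_conv i) Uu Ub l0 l1)).
  have := gu i; have := gm i; rewrite -/c.
  have : 0 <= l * (- m - g i ubar) by rewrite mulr_ge0// subr_ge0.
  have : 0 <= (1 - l) * (c * t - g i u) by rewrite mulr_ge0 ?subr_ge0//; exact: gu.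
  have := mulr_ge0 l0 (ltW (mulr_gt0 c0 t0)).
  by lra.
apply: (le_trans (convex_function_segment f_conv Uu Ub l0 l1)).
have := ler_wpM2l l0 (Fle u Uu).
move: xu; rewrite ler_norml -/c' => /andP[xu _].
have : t ^+ 2 <= t by rewrite expr2 ger_pMr.
have -> : (1 + c' + c / m * F) * r * s = t + c' * t + l * F by rewrite /l /t; ring.
by move: Lu xu; rewrite /lagrangian; lra.
Qed.

Lemma primal_lower_infeasibility xs u : dual_opt U f g xs -> U u ->
  d xs - enorm xs * enorm (pospart (gvec g u)) <= f u.
Proof.
move=> [xs0 _] Uu; have := dual_le xs Uu.
by have := dot_pospart_le (gvec g u) xs0; rewrite /lagrangian; lra.
Qed.

(** Compare the dual values at [0] and at [xs]: the gradient term of the minorant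
    supported at [xs] vanishes by slackness, leaving only its curvature. *)
Lemma primal_lower_quadratic xs u : dual_opt U f g xs -> U u ->
  d xs - Ld * enorm xs ^+ 2 <= f u.
Proof.
move=> xsopt Uu; have [xs0 _] := xsopt.
apply: (@le_of_small_error _ _ (Ld * enorm xs ^+ 2 + 5)) => t t0 t1.
have [v [Uv Lv _ xv]] := near_saddle xsopt Uu t0 t1.
have Lv' : Lag v xs - d xs <= t ^+ 2 by lra.
have := inexact_oracle 0 xs0 Uv Lv'; rewrite sub0r enormN !dual_at_zero.
have := dual_le 0 Uu; rewrite dual_at_zero.
have := dual_le xs Uv.
have : t ^+ 2 <= t by rewrite expr2 ger_pMr.
by move: xv; rewrite ler_norml /lagrangian => /andP[_ xv]; lra.
Qed.

(** The distance to an empty set is [0] by the convention on infima, so a positive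
    distance encodes the existence of dual optima. *)
Context (Rd_gt0 : 0 < dual_dist U f g 0).
Local Notation Rd := (dual_dist U f g 0).

Lemma near_dual_opt r :
  Rd < r -> exists2 xs, dual_opt U f g xs & enorm xs < r.
Proof.
move=> Rr.
have [hi|/inf_out hi] := pselect (has_inf [set enorm (0 - x) | x in dual_opt U f g]).
  have r0 : 0 < r - Rd by rewrite subr_gt0.
  have [_ [xs xsopt <-]] := inf_adherent r0 hi.
  by rewrite -/(dual_dist _ _ _ _) subrKC sub0r enormN => ?; exists xs.
by move: Rd_gt0; rewrite /dual_dist hi ltxx.
Qed.

Context {ubar : 'rV[R]_n} (U_ubar : U ubar) (g_ubar : forall i, g i ubar < 0).
Local Notation fopt := (opt_value U f g).

Lemma opt_lower_infeasibility u : U u ->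
  fopt - f u <= Rd * enorm (pospart (gvec g u)).
Proof.
move=> Uu; set G := enorm _.
apply: (@le_of_small_error _ _ G) => t t0 t1.
have [xs xsopt xsr] : exists2 xs, dual_opt U f g xs & enorm xs < Rd + t.
  by apply: near_dual_opt; rewrite ltrDl.
have := primal_lower_infeasibility xsopt Uu.
rewrite -(strong_duality xsopt U_ubar g_ubar) -/G.
have := ler_wpM2r (enorm_ge0 _ : 0 <= G) (ltW xsr).
by lra.
Qed.

Lemma opt_lower_quadratic u : U u -> fopt - f u <= Ld * Rd ^+ 2.
Proof.
move=> Uu; have Ld0 : 0 <= Ld by rewrite divr_ge0 ?sqr_ge0// ltW.
apply: (@le_of_small_error _ _ (Ld * (2 * Rd + 1))) => t t0 t1.
have [xs xsopt xsr] : exists2 xs, dual_opt U f g xs & enorm xs < Rd + t.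
  by apply: near_dual_opt; rewrite ltrDl.
have := primal_lower_quadratic xsopt Uu.
rewrite -(strong_duality xsopt U_ubar g_ubar).
have : enorm xs ^+ 2 <= Rd ^+ 2 + (2 * Rd + 1) * t.
  have := enorm_ge0 xs; nra.
by move=> /(ler_wpM2l Ld0); lra.
Qed.

End Duality.

(** * Estimate sequence of the dual fast gradient method *)

Section FastGradient.
Context {R : realType} {n p : nat}.
Context {f : 'rV[R]_n -> R} {g : 'I_p -> 'rV[R]_n -> R}.
Local Notation Lag := (lagrangian f g).

(** The sum of the step weights [(j + 1) / 2] for [j <= k]; the method is tuned so
    that [theta k] is the share of the last weight in [weight k.+1]. *)
Definition weight (k : nat) : R := k.+1%:R * k.+2%:R / 4.

Lemma weight_gt0 k : 0 < weight k.
Proof. by rewrite /weight divr_gt0// mulr_gt0// ltr0n. Qed.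

Lemma weightS k : weight k.+1 = weight k + k.+2%:R / 2.
Proof. by rewrite /weight; lra. Qed.

Lemma sum_weight k : \sum_(j < k.+1) weight j = weight k * (k.+3%:R / 3).
Proof.
elim: k => [|k IH]; first by rewrite big_ord_recr big_ord0/= /weight; lra.
by rewrite big_ord_recr/= IH /weight; field.
Qed.

Lemma theta_weight k : theta k * weight k.+1 = k.+2%:R / 2.
Proof.
have k0 : 0 <= k%:R :> R := ler0n _ _.
by rewrite /theta /weight; field; lra.
Qed.

Lemma theta_ge0 k : 0 <= theta k :> R.
Proof. by rewrite /theta divr_ge0// addr_ge0. Qed.

Lemma theta_le1 k : theta k <= 1 :> R.
Proof.
have k0 : 0 <= k%:R :> R := ler0n _ _.
by rewrite /theta ler_pdivrMr; lra.
Qed.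

(** Lets the strong concavity of the prox term pay for the curvature of the
    quadratic minorants; faster than quadratic growth of the weights would
    violate it. *)
Lemma theta_sqr_weight k : theta k ^+ 2 * weight k.+1 <= 1.
Proof.
have k0 : 0 <= k%:R :> R := ler0n _ _.
by rewrite expr2 -mulrA theta_weight /theta mulf_div ler_pdivrMr; lra.
Qed.

Lemma lagrangian_convex_comb u x z (t : R) :
  Lag u ((1 - t) *: x + t *: z) = (1 - t) * Lag u x + t * Lag u z.
Proof. by rewrite /lagrangian !dotE; ring. Qed.

Lemma sum_lagrangian (a : nat -> R) (u : nat -> 'rV[R]_n) x k :
  \sum_(j < k) a j * Lag (u j) x =
  \sum_(j < k) a j * f (u j) + dot x (\sum_(j < k) a j *: gvec g (u j)).
Proof.
rewrite dot_sumr -big_split/=; apply: eq_bigr => j _.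
by rewrite /lagrangian dotZr mulrDr.
Qed.

Context {Ld : R} {y0 : 'rV[R]_p} {u : nat -> 'rV[R]_n} {x y : nat -> 'rV[R]_p}.
Context (Ld_gt0 : 0 < Ld) (y0_ge0 : nonneg y0).
Context (dfg : dual_fast_gradient g Ld y0 u x y).

Lemma dfg_x_ge0 k : nonneg (x k).
Proof. by case: dfg => _ -> _; exact: pospart_ge0. Qed.

Lemma dfg_y_ge0 k : nonneg (y k).
Proof.
case: dfg => y0E _ yE; case: k => [|k]; first by rewrite y0E.
rewrite yE => i; rewrite !mxE addr_ge0// mulr_ge0 ?theta_ge0//.
- by rewrite subr_ge0 theta_le1.
- exact: dfg_x_ge0.
- by rewrite le_max lexx.
Qed.

Context {d : 'rV[R]_p -> R} {e : R}.
Context (d_le : forall j z, d z <= Lag (u j) z).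
Context (d_ge : forall j z, nonneg z ->
  Lag (u j) z - Ld * enorm (z - y j) ^+ 2 - e <= d z).

(** The projected step maximises the quadratic minorant of [d] supported at
    [y k], so its value at any [w] is a lower bound for [d (x k)]. *)
Lemma dfg_step k w : nonneg w ->
  Lag (u k) w - Ld * enorm (w - y k) ^+ 2 <= d (x k) + e.
Proof.
move=> w0; have := d_ge k (dfg_x_ge0 k).
case: dfg => _ -> _.
have /= := prox_step (gvec g (u k)) (y k) Ld_gt0 w0.
set z := pospart _; rewrite (lagrangianE _ w (y k)) (lagrangianE _ z (y k)).
by have := mulr_ge0 (ltW Ld_gt0) (sqr_ge0 (enorm (w - z))); lra.
Qed.

(** Nesterov's estimate sequence.  The left-hand side is maximal over the orthant at
    the projected aggregate point [v] entering the next [y], with quadratic loss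
    [Ld |z - v|^2] elsewhere.  In the induction step the weighted sum of the
    linear upper model at [x k] and at [z] equals that model at
    [w = (1 - theta k) x k + theta k z], and [w - y k.+1] is
    [theta k (z - v)]; so the quadratic loss turns into the curvature term at
    [w], and [dfg_step] applies.  Each step repeats the oracle error with the
    weight accumulated so far. *)
Lemma dfg_estimate k z : nonneg z ->
  \sum_(j < k.+1) j.+1%:R / 2 * Lag (u j) z - Ld * enorm (z - y0) ^+ 2 <=
  weight k * d (x k) + e * \sum_(j < k.+1) weight j.
Proof.
elim: k z => [|k IH] z z0.
  have := dfg_step 0 z0; case: dfg => -> _ _.
  rewrite !big_ord_recr !big_ord0/= !add0r /weight.
  by have := mulr_ge0 (ltW Ld_gt0) (sqr_ge0 (enorm (z - y0))); lra.
rewrite big_ord_recr [\sum_(j < k.+2) weight j]big_ord_recr /=.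
pose s := \sum_(j < k.+1) (j.+1%:R / 2) *: gvec g (u j).
pose v := pospart (y0 + (2 * Ld)^-1 *: s).
have v0 : nonneg v by exact: pospart_ge0.
have Hprox : \sum_(j < k.+1) j.+1%:R / 2 * Lag (u j) z - Ld * enorm (z - y0) ^+ 2 +
    Ld * enorm (z - v) ^+ 2 <= weight k * d (x k) + e * \sum_(j < k.+1) weight j.
  apply: le_trans (IH v v0).
  rewrite !(sum_lagrangian (fun j => j.+1%:R / 2)) -/s.
  have /= := prox_step s y0 Ld_gt0 z0.
  by rewrite -/v !dotDl !dotNl; lra.
pose w := (1 - theta k) *: x k + theta k *: z.
have w0 : nonneg w.
  move=> i; rewrite !mxE addr_ge0// mulr_ge0 ?theta_ge0//.
  - by rewrite subr_ge0 theta_le1.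
  - exact: dfg_x_ge0.
have wy : w - y k.+1 = theta k *: (z - v).
  case: dfg => _ _ ->; rewrite -/s -/v scalerBr.
  by rewrite opprD addrACA subrr add0r.
have := dfg_step k.+1 w0.
rewrite /w lagrangian_convex_comb -/w wy sqr_enorm dotZl dotZr -sqr_enorm.
move=> /(ler_wpM2l (ltW (weight_gt0 k.+1))).
have := d_le k.+1 (x k) => /(ler_wpM2l (ltW (weight_gt0 k))).
have := theta_weight k; have := weightS k.
have /(ler_wpM2l (mulr_ge0 (ltW Ld_gt0) (sqr_ge0 (enorm (z - v))))) := theta_sqr_weight k.
move: Hprox; set W := weight k; set W' := weight k.+1; set t := theta k.
set S := \sum_(i < _) _; set SW := \sum_(i < _) _.
set N := enorm (z - v) ^+ 2; set L1 := Lag _ (x k); set L2 := Lag _ z.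
move=> Hp Ht HW HtW Hd H.
have E : W' * ((1 - t) * L1 + t * L2 - Ld * (t * (t * N))) =
    W * L1 + k.+2%:R / 2 * L2 - Ld * N * (t ^+ 2 * W').
  have -> : W = W' - t * W' by rewrite HtW HW; lra.
  by rewrite -HtW; ring.
by rewrite E in H; lra.
Qed.

End FastGradient.

(** * The primal average *)

Section Average.
Context {R : realType} {n : nat}.
Implicit Types (u : nat -> 'rV[R]_n).

Lemma primal_average0 u : primal_average u 0 = u 0%N.
Proof.
by rewrite /primal_average big_ord_recr big_ord0/= add0r scale1r mul1r divff ?scale1r.
Qed.

Lemma primal_averageS u k : primal_average u k.+1 =
  (1 - theta k) *: primal_average u k + theta k *: u k.+1.
Proof.
have k0 : 0 <= k%:R :> R := ler0n _ _.
rewrite /primal_average big_ord_recr/= scalerDr !scalerA.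
congr (_ *: _ + _ *: _); rewrite /theta; field; lra.
Qed.

Context {U : set 'rV[R]_n} (U_conv : convex_set U).

Lemma primal_average_in u k : (forall j, U (u j)) -> U (primal_average u k).
Proof.
move=> Uu; elim: k => [|k IH]; first by rewrite primal_average0.
by rewrite primal_averageS; apply: convex_set_segment; rewrite ?theta_ge0 ?theta_le1.
Qed.

Lemma primal_average_jensen (h : 'rV[R]_n -> R) u k :
  convex_function U h -> (forall j, U (u j)) ->
  weight k * h (primal_average u k) <= \sum_(j < k.+1) j.+1%:R / 2 * h (u j).
Proof.
move=> hc Uu; elim: k => [|k IH].
  by rewrite primal_average0 big_ord_recr big_ord0/= /weight; lra.
rewrite primal_averageS big_ord_recr/=.
have Uk := primal_average_in k Uu.
have := convex_function_segment hc Uk (Uu k.+1) (theta_ge0 k) (theta_le1 k).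
move=> /(ler_wpM2l (ltW (weight_gt0 k.+1))) /le_trans; apply.
have := theta_weight k (R := R); have := weightS k (R := R).
set W := weight k; set W' := weight k.+1; set t := theta k => HW HtW.
set a := h (primal_average u k); set b := h (u k.+1).
have -> : W' * ((1 - t) * a + t * b) = W * a + k.+2%:R / 2 * b.
  have -> : W = W' - t * W' by rewrite HtW HW; lra.
  by rewrite -HtW; ring.
by rewrite lerD2r.
Qed.

End Average.

Section PrimalBound.
Context {R : realType} {n p : nat} {U : set 'rV[R]_n}.
Context {f : 'rV[R]_n -> R} {g : 'I_p -> 'rV[R]_n -> R}.
Context (U_conv : convex_set U) (f_conv : convex_function U f).
Context (g_conv : forall i, convex_function U (g i)).

Lemma lagrangian_convex z : nonneg z ->
  convex_function U (fun v => lagrangian f g v z).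
Proof.
move=> z0 t v w Uv Uw; rewrite convRE /lagrangian.
suff : dot z (gvec g (conv t v w)) <=
    dot z (t%:num *: gvec g v + (1 - t%:num) *: gvec g w).
  by rewrite dotDr !dotZr; have := f_conv t Uv Uw; rewrite convRE/= /unstable.onem; lra.
apply: ler_sum => i _; rewrite ler_wpM2l// !mxE.
by have := g_conv i t Uv Uw; rewrite convRE.
Qed.

Lemma lagrangian_average (u : nat -> 'rV[R]_n) k z : (forall j, U (u j)) -> nonneg z ->
  weight k * lagrangian f g (primal_average u k) z <=
  \sum_(j < k.+1) j.+1%:R / 2 * lagrangian f g (u j) z.
Proof.
move=> Uu z0.
exact: (primal_average_jensen U_conv k (lagrangian_convex z0) Uu).
Qed.

(** Evaluate the estimate sequence at a multiple [c q] of the infeasibility [q] of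
    the average.  The linear part contributes [c |q|^2] and the prox term costs
    [c^2 |q|^2 Ld / weight k]; the chosen [c] maximises the difference. *)
Lemma dfg_primal_bound (Ld e F : R) (d : 'rV[R]_p -> R)
    (u : nat -> 'rV[R]_n) (x y : nat -> 'rV[R]_p) (k : nat) : 0 < Ld ->
  dual_fast_gradient g Ld 0 u x y -> (forall j, U (u j)) ->
  (forall j z, d z <= lagrangian f g (u j) z) ->
  (forall j z, nonneg z ->
     lagrangian f g (u j) z - Ld * enorm (z - y j) ^+ 2 - e <= d z) ->
  (forall z, nonneg z -> d z <= F) ->
  f (primal_average u k) +
    weight k / (4 * Ld) * enorm (pospart (gvec g (primal_average u k))) ^+ 2 <=
  F + e * (k.+3%:R / 3).
Proof.
move=> Ld0 dfg Uu d_le d_ge dF.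
set ub := primal_average u k; set q := pospart _; set W := weight k.
have W0 : 0 < W := weight_gt0 k.
pose c := W / (2 * Ld).
have c0 : 0 <= c by rewrite divr_ge0 ?mulr_ge0// ltW.
have z0 : nonneg (c *: q).
  by move=> i; rewrite mxE mulr_ge0//; exact: pospart_ge0.
have := dfg_estimate Ld0 dfg d_le d_ge k z0.
have := lagrangian_average k Uu z0.
have := ler_wpM2l (ltW W0) (dF _ (dfg_x_ge0 dfg k)).
rewrite subr0 sum_weight sqr_enorm !dotZl dotZr -sqr_enorm /lagrangian dotZl dot_pospart.
rewrite -/W -/ub -/q => H1 H2 H3.
rewrite -(ler_pM2l W0).
have -> : W * (f ub + W / (4 * Ld) * enorm q ^+ 2) =
  W * (f ub + c * enorm q ^+ 2) - Ld * (c * (c * enorm q ^+ 2)).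
  by rewrite /c; field; rewrite gt_eqF.
by lra.
Qed.

End PrimalBound.

(** * Counting iterations *)

Section Complexity.
Context {R : realType}.

(** With [b] the real number of iterations before rounding, the inner accuracy is
    at most [sqrt 32 / 8] times [eps / b], and 17/24 is a rational upper bound of
    [sqrt 32 / 8]. *)
Lemma accuracy_scaling (Ld Rd eps delta : R) : 1 <= Ld -> 1 <= Rd -> 0 < eps ->
  delta <= eps `^ (3 / 2) / (8 * Num.sqrt Ld * Rd) ->
  let b := Num.sqrt (32 * Ld * Rd ^+ 2 / eps) in
  b ^+ 2 * eps = 32 * Ld * Rd ^+ 2 /\ b * delta <= 17 / 24 * eps.
Proof.
move=> Ld1 Rd1 eps0 hd /=; set b := Num.sqrt _.
have b2 : b ^+ 2 * eps = 32 * Ld * Rd ^+ 2.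
  rewrite sqr_sqrtr ?divfK ?gt_eqF// divr_ge0// ?(ltW eps0)//.
  by rewrite mulr_ge0 ?sqr_ge0//; lra.
split=> //.
have b0 : 0 <= b := sqrtr_ge0 _.
have sL0 : 0 < Num.sqrt Ld by rewrite sqrtr_gt0; lra.
have sLE : Num.sqrt Ld ^+ 2 = Ld by rewrite sqr_sqrtr//; lra.
have se0 : 0 < Num.sqrt eps by rewrite sqrtr_gt0.
have seE : Num.sqrt eps ^+ 2 = eps by rewrite sqr_sqrtr// ltW.
have Rd0 : 0 < Rd by lra.
have r0 : 0 < Num.sqrt Ld * Rd by rewrite mulr_gt0.
(* [17 / 3] exceeds [sqrt 32]. *)
have br : b * Num.sqrt eps <= 17 / 3 * (Num.sqrt Ld * Rd).
  have c0 : 0 <= 17 / 3 * (Num.sqrt Ld * Rd) by rewrite mulr_ge0// ltW.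
  have a0 : 0 <= b * Num.sqrt eps by rewrite mulr_ge0// ltW.
  suff : (b * Num.sqrt eps) ^+ 2 <= (17 / 3 * (Num.sqrt Ld * Rd)) ^+ 2.
    by rewrite ler_pXn2r.
  have -> : (b * Num.sqrt eps) ^+ 2 = 32 * (Num.sqrt Ld * Rd) ^+ 2.
    by rewrite !exprMn seE sLE b2 -mulrA.
  rewrite [X in _ <= X]exprMn ler_pM2r ?exprn_gt0//.
  by lra.
have powE : eps `^ (3 / 2) = eps * Num.sqrt eps.
  rewrite (_ : 3 / 2 = 1 + 2^-1); last by lra.
  by rewrite powRD ?powRr1 ?ltW// ?powR12_sqrt ?ltW// gt_eqF ?implybT.
apply: (le_trans (ler_wpM2l b0 hd)); rewrite powE.
have -> : b * (eps * Num.sqrt eps / (8 * Num.sqrt Ld * Rd)) =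
  b * Num.sqrt eps * eps / (8 * (Num.sqrt Ld * Rd)) by rewrite -!mulrA; ring.
rewrite ler_pdivrMr ?mulr_gt0//.
by have := ler_wpM2r (ltW eps0) br; lra.
Qed.

(** Here [D] is the objective error of the average, [G] its infeasibility, and the
    rounded number of iterations is [k + 1].  For [k >= 3] the bound
    [- D <= Rd G] suffices: if [S = Rd G] exceeded [eps], the quadratic term in
    [G] would outweigh [S] and the accumulated inner error.  For [k < 3] rounding
    loses too much for this, but then [b < 4] means [Ld Rd^2 <= eps / 2], and the
    bound on [- D] that does not involve [G] is the better one.  For [k = 0] the
    accumulated error may exceed [eps], and [D] is controlled by the accuracy of
    the single inner solution. *)
Lemma eps_optimal_arith (k : nat) (b eps delta Ld Rd D G : R) :
  0 < eps -> 0 < delta -> 0 < Ld -> 1 <= Rd -> 0 <= G ->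
  k.+1%:R <= b -> b < k.+2%:R ->
  b ^+ 2 * eps = 32 * Ld * Rd ^+ 2 -> b * delta <= 17 / 24 * eps ->
  D + weight k / (4 * Ld) * G ^+ 2 <= 2 * delta * (k.+3%:R / 3) ->
  - D <= Rd * G -> - D <= Ld * Rd ^+ 2 -> (k = 0%N -> D <= delta) ->
  `|D| <= eps /\ G <= eps.
Proof.
move=> eps0 delta0 Ld0 Rd1 G0 kb bk b2 bd HP HA HB HC.
set eta := 2 * delta * _ in HP.
have W0 : 0 < weight k :> R := weight_gt0 k.
have k0 : 0 <= k%:R :> R := ler0n _ _.
have b1 : 1 <= b by apply: le_trans kb; lra.
have beta : b * eta <= 17 / 36 * (k%:R + 3) * eps.
  have := ler_wpM2r (_ : 0 <= k%:R + 3) bd; rewrite /eta => /(_ ltac:(lra)); lra.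
have eta0 : 0 <= eta by rewrite /eta !mulr_ge0//; lra.
have WG0 : 0 <= weight k / (4 * Ld) * G ^+ 2.
  by rewrite mulr_ge0 ?sqr_ge0// divr_ge0 ?ltW// mulr_gt0.
have Rd2 : 1 <= Rd ^+ 2 by rewrite exprn_ege1.
have upper : D <= eps.
  case: (posnP k) => [/HC|k_gt0]; first by nra.
  have k1 : 1 <= k%:R :> R by rewrite ler1n.
  have h1 : k.+1%:R * eta <= b * eta by rewrite ler_wpM2r.
  have h2 : k.+1%:R * D <= k.+1%:R * eta by rewrite ler_pM2l ?ltr0n//; lra.
  have h3 := ler_wpM2r (ltW eps0) k1.
  by rewrite -(@ler_pM2l _ k.+1%:R) ?ltr0n//; lra.
have WE : weight k / (4 * Ld) * G ^+ 2 * (4 * Ld) = weight k * G ^+ 2.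
  by field; rewrite gt_eqF.
have [k3|k3] := leqP 3 k.
  have {}k3 : 3 <= k%:R :> R by rewrite ler_nat.
  suff S1 : Rd * G <= eps by split; [rewrite ler_norml upper andbT; lra|nra].
  rewrite leNgt; apply/negP => S1; set S := Rd * G in HA S1.
  have S0 : 0 < S by apply: lt_trans S1.
  (* The infeasibility bound, multiplied by [b ^+ 2 * eps = 32 Ld Rd^2]. *)
  have key : 2 * k.+1%:R * k.+2%:R * S ^+ 2 <= b ^+ 2 * eps * (S + eta).
    rewrite b2.
    have : weight k / (4 * Ld) * G ^+ 2 <= S + eta by lra.
    have c0 : 0 <= 32 * Ld * Rd ^+ 2 by rewrite -b2 mulr_ge0 ?sqr_ge0// ltW.
    move=> /(ler_wpM2l c0); apply: le_trans.
    rewrite (_ : 32 * Ld * Rd ^+ 2 * _ = 8 * Rd ^+ 2 * (weight k * G ^+ 2)).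
      by rewrite /weight /S; lra.
    by rewrite -WE; ring.
  have h1 : b ^+ 2 * eps * eta <= b * (17 / 36 * (k%:R + 3) * eps) * eps.
    have -> : b ^+ 2 * eps * eta = b * (b * eta) * eps by ring.
    by apply: (ler_wpM2r (ltW eps0)); apply: ler_wpM2l => //; lra.
  have K0 : 0 < k.+2%:R :> R by rewrite ltr0n.
  have b0 : 0 <= b by lra.
  have es := ltW S1; have e0 := ltW eps0; have s0 := ltW S0.
  have h2 : b * (eps * eps) <= k.+2%:R * (S * S).
    exact: ler_pM b0 (mulr_ge0 e0 e0) (ltW bk) (ler_pM e0 e0 es es).
  have b2k : b ^+ 2 <= k.+2%:R ^+ 2 := ler_pM b0 b0 (ltW bk) (ltW bk).
  have h3 : b ^+ 2 * (eps * S) <= k.+2%:R ^+ 2 * (S * S).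
    exact: ler_pM (sqr_ge0 b) (mulr_ge0 e0 s0) b2k (ler_pM e0 s0 es (lexx S)).
  have c0 : 0 <= 17 / 36 * (k%:R + 3) :> R by lra.
  have h4 := ler_wpM2l c0 h2.
  have KS0 : 0 < k.+2%:R * (S * S) by apply: mulr_gt0 => //; exact: mulr_gt0.
  have h5 : 2 * k.+1%:R <= k.+2%:R + 17 / 36 * (k%:R + 3) :> R.
    by rewrite -(ler_pM2l KS0); lra.
  (* [h5] forces [k <= 51 / 19]. *)
  by clear -h5 k3; lra.
have b0 : 0 <= b by lra.
have b4 : b <= 4 by apply: ltW; apply: (lt_le_trans bk); rewrite ler_nat.
have bE : b ^+ 2 * eps <= 16 * eps.
  by rewrite ler_pM2r//; have := ler_pM b0 b0 b4 b4; lra.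
split; first (by rewrite ler_norml upper andbT; lra).
rewrite leNgt; apply/negP => G1.
(* The infeasibility bound, multiplied by [4 Ld <= 4 Ld Rd^2 = b^2 eps / 8]. *)
have h1 : 2 * k.+1%:R * k.+2%:R * G ^+ 2 <= b ^+ 2 * eps * (b ^+ 2 * eps / 32 + eta).
  have : weight k / (4 * Ld) * G ^+ 2 <= b ^+ 2 * eps / 32 + eta by lra.
  have L40 : 0 <= 4 * Ld by lra.
  move=> /(ler_wpM2r L40); rewrite WE => h.
  have h' : 4 * Ld <= b ^+ 2 * eps / 8 by rewrite b2; nra.
  have t0 : 0 <= b ^+ 2 * eps / 32 + eta.
    by rewrite addr_ge0// divr_ge0// mulr_ge0 ?sqr_ge0// ltW.
  have := ler_wpM2l t0 h'; move: h; rewrite /weight; lra.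
have h2 : b ^+ 2 * eps * eta <= b * (17 / 36 * (k%:R + 3) * eps) * eps.
  have -> : b ^+ 2 * eps * eta = b * (b * eta) * eps by ring.
  by apply: (ler_wpM2r (ltW eps0)); apply: ler_wpM2l => //; lra.
have h3 : b ^+ 2 <= k.+2%:R ^+ 2 := ler_pM b0 b0 (ltW bk) (ltW bk).
have h4 : b ^+ 2 * b ^+ 2 <= k.+2%:R ^+ 2 * k.+2%:R ^+ 2 by rewrite ler_pM ?sqr_ge0.
have e2 : 0 < eps ^+ 2 by rewrite exprn_gt0.
have G2 : eps ^+ 2 < G ^+ 2 by rewrite ltr_pXn2r ?nnegrE// ltW.
have h5 := ler_wpM2r (ltW e2) h4.
have h6 := ler_wpM2r (ltW e2) (ltW bk).
clearbody eta; move: k3 h1 h2 h5 h6; clear -e2 G2.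
by case: k => [|[|[|//]]] _ h1 h2 h5 h6; lra.
Qed.

Lemma truncnM_le (a b : R) :
  0 <= a -> (Num.truncn a * Num.truncn b <= Num.truncn (a * b))%N.
Proof.
move=> a0; have [b0|b0] := leP 0 b; last first.
  suff -> : Num.truncn b = 0%N by rewrite muln0.
  by apply/eqP; rewrite -leqn0 truncn_le_nat; lra.
by rewrite truncn_ge_nat ?mulr_ge0// natrM ler_pM// truncn_le.
Qed.

End Complexity.

(** * Complexity of the inexact dual fast gradient method *)

Theorem theorem4 (R : realType) (n p : nat)
  (U domf : set 'rV[R]_n) (domg : 'I_p -> set 'rV[R]_n)
  (f : 'rV[R]_n -> R) (g : 'I_p -> 'rV[R]_n -> R)
  (sf Lf cg Ld Rd eps delta : R) (y0 : 'rV[R]_p)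
  (U_closed : closed U) (U_convex : convex_set U)
  (f_cvx : convex_differentiable domf f)
  (g_cvx : forall i, convex_differentiable (domg i) (g i))
  (U_dom : U `<=` domf `&` \bigcap_i domg i)
  (slater : exists ubar, relint U ubar /\ forall i, g i ubar < 0)
  (sf_gt0 : 0 < sf)
  (f_strong_smooth : forall u v, U u -> U v ->
     sf / 2 * enorm (u - v) ^+ 2 <= f u - (f v + dot (grad f v) (u - v))
       <= Lf / 2 * enorm (u - v) ^+ 2)
  (cg_gt0 : 0 < cg)
  (jac_bound : forall u, U u -> frobenius (jac_g g u) <= cg)
  (LdE : Ld = cg ^+ 2 / sf)
  (RdE : Rd = dual_dist U f g y0)
  (y0E : y0 = 0)
  (Rd_ge : [/\ 1 <= Rd, cg^-1 <= Rd & Lf / cg <= Rd])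
  (Ld_ge1 : 1 <= Ld)
  (eps_gt0 : 0 < eps) (delta_gt0 : 0 < delta)
  (delta_le : delta <= eps `^ (3 / 2) / (8 * Num.sqrt Ld * Rd)) :
  (* (i) : [k.+1] outer iterations, those of index 0, ..., k, produce
     [primal_average u k] *)
  (forall (u : nat -> 'rV[R]_n) (x y : nat -> 'rV[R]_p),
     IDFGM U f g delta Ld y0 u x y ->
     forall k, k.+1 = Num.truncn (Num.sqrt (32 * Ld * Rd ^+ 2 / eps)) ->
     eps_optimal U f g eps (primal_average u k))
  /\
  (* (ii) : each of the [k.+1] inner solves makes [nesterov_steps ...]
     projections and gradient evaluations *)
  (delta = eps `^ (3 / 2) / (8 * Num.sqrt Ld * Rd) ->
   forall (Rp : R) (v0 : nat -> 'rV[R]_n),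
     (forall j, U (v0 j)) ->
     (forall j x ux, nonneg x ->
        is_argmin U (fun u => lagrangian f g u x) ux ->
        enorm (v0 j - ux) <= Rp) ->
     (forall j x v, nonneg x ->
        nesterov_output U f g domf sf Lf (nesterov_steps sf Lf Rp delta)
          x (v0 j) v ->
        inexact_min U f g delta x v) ->
   forall (u : nat -> 'rV[R]_n) (x y : nat -> 'rV[R]_p),
     dual_fast_gradient g Ld y0 u x y ->
     (forall j,
        nesterov_output U f g domf sf Lf (nesterov_steps sf Lf Rp delta)
          (y j) (v0 j) (u j)) ->
   forall k, k.+1 = Num.truncn (Num.sqrt (32 * Ld * Rd ^+ 2 / eps)) ->
     eps_optimal U f g eps (primal_average u k) /\
     (k.+1 * nesterov_steps sf Lf Rp delta <=
        Num.truncn (Num.sqrt (Lf / sf) * Num.sqrt (32 * Ld * Rd ^+ 2 / eps) *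
          ln (4 * Num.sqrt Ld * Lf * Rp ^+ 2 * Rd / eps `^ (3 / 2))))%N).
Proof.
case: Rd_ge => Rd_ge1 _ _; case: slater => ubar [[U_ubar _] g_ubar].
case: f_cvx => _ f_convD _; subst y0.
have f_conv : convex_function U f.
  by apply: convex_functionS f_convD => u /U_dom[].
have U_domg i : U `<=` domg i by move=> u /U_dom[_]; apply.
have g_conv i : convex_function U (g i).
  by have [_ gc _] := g_cvx i; exact: convex_functionS gc.
have f_growth u v : U u -> U v ->
    f v + dot (grad f v) (u - v) + sf / 2 * enorm (u - v) ^+ 2 <= f u.
  by move=> Uu Uv; have /andP[] := f_strong_smooth u v Uu Uv; lra.
have g_lip : forall w u v, U u -> U v ->
    dot w (gvec g u) - dot w (gvec g v) <= cg * enorm w * enorm (u - v).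
  apply: gvec_lipschitz => // i u /(U_domg i) Du.
  by have [_ _] := g_cvx i; exact.
have zero_ge0 : nonneg (0 : 'rV[R]_p) by move=> i; rewrite mxE.
have Rd_gt0 : 0 < dual_dist U f g 0 by rewrite -RdE; lra.
have Ld_gt0 : 0 < Ld by lra.
have [bE bdelta] := accuracy_scaling Ld_ge1 Rd_ge1 eps_gt0 delta_le.
set b := Num.sqrt (32 * Ld * Rd ^+ 2 / eps) in bE bdelta *.
have b_ge0 : 0 <= b by exact: sqrtr_ge0.
have d_opt z : nonneg z -> dual U f g z <= opt_value U f g.
  by move=> z0; apply: (dual_le_opt_value sf_gt0 f_growth g_lip z0 U_ubar) => i;
    exact: ltW.
have partI (u : nat -> 'rV[R]_n) (x y : nat -> 'rV[R]_p) :
    IDFGM U f g delta Ld 0 u x y ->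
    forall k, k.+1 = Num.truncn b -> eps_optimal U f g eps (primal_average u k).
  move=> [dfg inexact] k kE.
  have Uu j : U (u j) by have [] := inexact j.
  have Ua := primal_average_in U_convex k Uu.
  have /andP[kb bk] := truncn_itv b_ge0; rewrite -kE in kb bk.
  have d_ge j z : nonneg z ->
      lagrangian f g (u j) z - Ld * enorm (z - y j) ^+ 2 - 2 * delta <=
      dual U f g z.
    move=> _; rewrite LdE; have [_ /andP[_ ud]] := inexact j.
    by apply: inexact_oracle ud => //; exact: dfg_y_ge0 zero_ge0 dfg j.
  have key := dfg_primal_bound U_convex f_conv g_conv k Ld_gt0 dfg Uu
    (fun j z => dual_le sf_gt0 f_growth g_lip z (Uu j)) d_ge d_opt.
  have lowG := opt_lower_infeasibility U_convex f_conv g_conv sf_gt0 f_growth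
    g_lip Rd_gt0 U_ubar g_ubar Ua.
  have lowQ := opt_lower_quadratic U_convex f_conv g_conv sf_gt0 f_growth
    g_lip Rd_gt0 U_ubar g_ubar Ua.
  rewrite -RdE in lowG; rewrite -RdE -LdE in lowQ.
  set D := f (primal_average u k) - opt_value U f g.
  have [] : `|D| <= eps /\ enorm (pospart (gvec g (primal_average u k))) <= eps.
    apply: (eps_optimal_arith eps_gt0 delta_gt0 Ld_gt0 Rd_ge1 _ kb bk bE bdelta).
    - exact: enorm_ge0.
    - by rewrite /D; lra.
    - by rewrite /D opprB.
    - by rewrite /D opprB.
    - (* The first dual iterate is 0, where the Lagrangian is [f]. *)
      move=> k0; rewrite /D k0 primal_average0.
      have [_ /andP[_]] := inexact 0%N; case: dfg => -> _ _.
      by rewrite dual_at_zero; have := d_opt 0 zero_ge0; lra.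
  by split.
split=> // deltaE Rp v0 Uv0 _ nesterov u x y dfg uE k kE; split.
  apply: (partI u x y _ k kE); split=> // j.
  by apply: nesterov (uE j); exact: dfg_y_ge0 zero_ge0 dfg j.
rewrite kE /nesterov_steps.
have -> : Lf * Rp ^+ 2 / (2 * delta) =
    4 * Num.sqrt Ld * Lf * Rp ^+ 2 * Rd / eps `^ (3 / 2).
  rewrite deltaE; field.
  by rewrite !gt_eqF ?sqrtr_gt0 ?powR_gt0//; lra.
by rewrite (mulrC _ b) -(mulrA b); exact: truncnM_le.
Qed.
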